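(* Let $(\mathbb{Z},E)$ be a self-similar graph, and fix any infinite path $x\in E^\infty$. There exists an injective continuous homomorphism $$\Omega\colon\widehat{\mathcal{S}}_{\mathrm{sym}}(x)\to X(x)=\varprojlim_i(X_i(x),f_{i,j})$$ uniquely determined by $(\pi_n\circ\Omega)(\kappa)=\kappa(\mathfrak{s}_n)$ for all $\kappa\in\widehat{\mathcal{S}}_{\mathrm{sym}}(x)$ and $n\in\mathbb{N}$. If $(\mathbb{Z},E)$ is pseudo-free, then $\Omega$ is an isomorphism of topological groups, whose inverse maps $\vec z\in X(x)$ to the continuous homomorphism $\Omega^{-1}(\vec z)\colon\mathcal{S}_{\mathrm{sym}}(x)\to\mathbb{T}$ that is uniquely determined by $\Omega^{-1}(\vec z)(\mathfrak{s}_n)=\pi_n(\vec z)$ for all $n\in\mathbb{N}$.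
   Context: Graphs. $\mathbb{N}=\{0,1,2,\dots\}$. A directed graph $E=(E^0,E^1,r,s)$ has vertex set $E^0$, edge set $E^1$, range and source maps $r,s\colon E^1\to E^0$. All graphs are finite ($E^0,E^1$ finite) and source-free (every vertex is the range of some edge). A path of length $n\ge1$ is a word $e_1\cdots e_n$ of edges with $s(e_i)=r(e_{i+1})$, with range $r(e_1)$ and source $s(e_n)$; vertices are the paths of length $0$. $E^*$ is the set of finite paths, $|\mu|$ the length. $E^\infty$ is the set of infinite paths $x=e_1e_2\cdots$ ($s(e_i)=r(e_{i+1})$), $r(x)=r(e_1)$; $x(m,n)=e_{m+1}\cdots e_n$ for $m<n$, $x(n,n)=r(e_{n+1})$, $\sigma^n(x)=e_{n+1}e_{n+2}\cdots$. $vE^\infty$ is the set of infinite paths with range $v$. Self-similar graph $(G,E)$ with $G=\mathbb{Z}=\langle a\rangle$, written multiplicatively with identity $1_G$: $G$ acts on $E^*$ by bijections preserving lengths and commuting with $r,s$, with a restriction map $(g,\mu)\mapsto g|_\mu\in G$ such that $(gh)|_\mu=g|_{h\cdot\mu}h|_\mu$; $g|_v=g$ for $v\in E^0$; $1_G|_\mu=1_G$; $g|_{\mu\nu}=g|_\mu|_\nu$ and $g\cdot(\mu\nu)=(g\cdot\mu)(g|_\mu\cdot\nu)$ whenever $s(\mu)=r(\nu)$. The action extends to $E^\infty$ by $(g\cdot x)(p,q)=g|_{x(0,p)}\cdot x(p,q)$, and $g|_x\colon\mathbb{N}\to G$ is $p\mapsto g|_{x(0,p)}$. $(G,E)$ is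 pseudo-free if $g\cdot\mu=\mu$ and $g|_\mu=1_G$ imply $g=1_G$. $Q(\mathbb{N},\mathbb{Z})$ is the group of functions $\mathbb{N}\to G$ (pointwise product) modulo eventual equality, $[f]$ the class of $f$. For $n\in\mathbb{Z}$, $\mathcal{T}_n(f)(p)=f(p-n)$ if $p\ge n$ and $1_G$ otherwise, inducing an automorphism $\mathcal{T}_n$ of $Q(\mathbb{N},\mathbb{Z})$. The group $\mathcal{S}_{\mathrm{sym}}(x)$. For $v\in E^0$ let $\mathbb{Z}_v=\{g\in\mathbb{Z}:g\cdot y=y\text{ for all }y\in vE^\infty\}$, a subgroup of $\mathbb{Z}$. The fibre at $x$ of the symmetric cycline subgroupoid of the self-similar path groupoid is the (discrete, abelian) group $$\mathcal{S}_{\mathrm{sym}}(x)=\{(x;\mathcal{T}_n([f|_{\sigma^n(x)}]),0;x): n\in\mathbb{N},\ f\in\mathbb{Z}_{x(n,n)}\},$$ with multiplication that of the middle coordinate in $Q(\mathbb{N},\mathbb{Z})$. Its Pontryagin dual $\widehat{\mathcal{S}}_{\mathrm{sym}}(x)$ is the group of homomorphisms $\mathcal{S}_{\mathrm{sym}}(x)\to\mathbb{T}$ with pointwise product and topology of pointwise convergence. The inverse system. For $n\in\mathbb{N}$ let $h_n=a^m$, with unique $m\in\mathbb{N}$, be the generator of $\mathbb{Z}_{x(n,n)}$, and let $$\mathfrak{s}_n=(x;\mathcal{T}_n([h_n|_{\sigma^n(x)}]),0;x)\in\mathcal{S}_{\mathrm{sym}}(x).$$ For each $n$ there is $k_n\in\mathbb{Z}$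 with $h_n|_{x(n,n+1)}=h_{n+1}^{k_n}$; it is unique if $h_{n+1}\ne1_G$, and one takes $k_n=0$ if $h_{n+1}=1_G$. Put $k_{i,i}=1$ and $k_{i,j}=\prod_{i\le n<j}k_n$ for $i<j$. If $h_i=1_G$ for all $i$, let $X_i(x)=\{1\}$ for all $i$. Otherwise let $N$ be minimal with $h_N\ne1_G$ and let $X_i(x)=\{1\}$ for $i<N$ and $X_i(x)=\mathbb{T}$ for $i\ge N$. For $i\le j$ let $f_{i,j}\colon X_j(x)\to X_i(x)$, $z\mapsto z^{k_{i,j}}$. This is an inverse system of topological groups; $X(x)$ is its inverse limit with projections $\pi_i\colon X(x)\to X_i(x)$ satisfying $\pi_i=f_{i,j}\circ\pi_j$. *)

(* Defs.v *)
From HB Require Import structures.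
From mathcomp Require Import all_boot all_order all_algebra.
From mathcomp Require Import all_classical all_reals all_analysis.
From mathcomp Require Import complex zify.
Set Implicit Arguments.
Unset Strict Implicit.
Unset Printing Implicit Defensive.
Import Order.TTheory GRing.Theory Num.Theory.
Import numFieldNormedType.Exports.
Local Open Scope classical_set_scope.
Local Open Scope ring_scope.
Local Open Scope quotient_scope.

Record graph := Graph {
  vert : finType;
  edge : finType;
  rng : edge -> vert;
  src : edge -> vert;
  source_free : forall v, exists e, rng e = v
}.
Arguments rng {g}.
Arguments src {g}.

Fixpoint walk (E : graph) (v : vert E) (es : seq (edge E)) : bool :=
  if es is e :: es' then (rng e == v) && walk (src e) es' else true.

(* The range is stored separately because the edge word of a path of length 0
   does not determine its vertex. *)
Record gpath (E : graph) := GPath {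
  prange : vert E;
  pedges : seq (edge E);
  pedgesP : walk prange pedges
}.

Definition psource (E : graph) (mu : gpath E) : vert E :=
  last (prange mu) [seq src e | e <- pedges mu].

Definition plen (E : graph) (mu : gpath E) : nat := size (pedges mu).

Definition vpath (E : graph) (v : vert E) : gpath E :=
  @GPath E v [::] isT.

(* [is_cat mu nu la]: mu and nu are composable and la = mu nu. *)
Definition is_cat (E : graph) (mu nu la : gpath E) : Prop :=
  [/\ psource mu = prange nu, prange la = prange mu
    & pedges la = pedges mu ++ pedges nu].

(* [iedge x n] is the edge written e_(n+1) in x = e_1 e_2 ... *)
Record inf_path (E : graph) := InfPath {
  iedge : nat -> edge E;
  iedgeP : forall n, src (iedge n) = rng (iedge n.+1)
}.

Definition irange (E : graph) (x : inf_path E) : vert E := rng (iedge x 0).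

(* The vertex x(n, n). *)
Definition ivert (E : graph) (x : inf_path E) (n : nat) : vert E :=
  rng (iedge x n).

Lemma walk_iota (E : graph) (x : inf_path E) (m d : nat) :
  walk (rng (iedge x m)) [seq iedge x k | k <- iota m d].
Proof.
elim: d m => [|d IH] m //=; rewrite eqxx /=.
by rewrite iedgeP; exact: IH.
Qed.

(* x(m, n), for m <= n. *)
Definition iseg (E : graph) (x : inf_path E) (m n : nat) : gpath E :=
  GPath (walk_iota x m (n - m)).

Definition ishift (E : graph) (n : nat) (x : inf_path E) : inf_path E :=
  @InfPath E (fun k => iedge x (n + k))
    (fun k => eq_trans (iedgeP x (n + k))
                (f_equal (fun i => rng (iedge x i)) (esym (addnS n k)))).

Lemma gpathP (E : graph) (mu nu : gpath E) :
  prange mu = prange nu -> pedges mu = pedges nu -> mu = nu.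
Proof.
case: mu nu => [v s p] [w t q] /= vw st.
by case: w / vw q => q; case: t / st q => q; rewrite (bool_irrelevance p q).
Qed.

Lemma inf_pathP (E : graph) (x y : inf_path E) :
  (forall n, iedge x n = iedge y n) -> x = y.
Proof.
case: x y => [f p] [g q] /= fg; have {}fg : f = g by apply: funext.
by case: g / fg q => q; rewrite (Prop_irrelevance p q).
Qed.

Lemma iseg_vertex (E : graph) (x : inf_path E) (n : nat) :
  iseg x n n = vpath (ivert x n).
Proof. by apply: gpathP => //=; rewrite subnn. Qed.

Lemma iseg_cat (E : graph) (x : inf_path E) (m n p : nat) :
  (m <= n)%N -> (n <= p)%N -> is_cat (iseg x m n) (iseg x n p) (iseg x m p).
Proof.
move=> mn np; split => //=; last first.
  rewrite -map_cat; congr map.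
  have -> : (p - m = (n - m) + (p - n))%N by lia.
  by rewrite iotaD subnKC.
rewrite /psource /= -map_comp; move: mn => /subnK <-.
move: (n - m)%N => d {np}; rewrite addnK addnC.
case: d => [|d]; first by rewrite addn0.
by rewrite -addn1 iotaD map_cat last_cat /= iedgeP addn1 addnS.
Qed.

(* The group Z is the additive group of [int]; the generator a is 1 : int. *)
Record self_similar (E : graph) := SelfSimilar {
  act : int -> gpath E -> gpath E;
  rst : int -> gpath E -> int;
  act0 : forall mu, act 0 mu = mu;
  actD : forall g h mu, act (g + h) mu = act g (act h mu);
  act_len : forall g mu, plen (act g mu) = plen mu;
  act_range : forall g mu,
    vpath (prange (act g mu)) = act g (vpath (prange mu));
  act_source : forall g mu,
    vpath (psource (act g mu)) = act g (vpath (psource mu));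
  rstD : forall g h mu, rst (g + h) mu = rst g (act h mu) + rst h mu;
  rst_vertex : forall g v, rst g (vpath v) = g;
  rst0 : forall mu, rst 0 mu = 0;
  rst_cat : forall g mu nu la,
    is_cat mu nu la -> rst g la = rst (rst g mu) nu;
  act_cat : forall g mu nu la,
    is_cat mu nu la -> is_cat (act g mu) (act (rst g mu) nu) (act g la)
}.

Definition pseudo_free (E : graph) (A : self_similar E) : Prop :=
  forall g mu, act A g mu = mu -> rst A g mu = 0 -> g = 0.

Section InfiniteAction.
Variables (E : graph) (A : self_similar E).
Implicit Types (g : int) (x : inf_path E) (n p q : nat).

(* The path (g . x)(p, p + 1), which has length 1. *)
Let step g x p : gpath E := act A (rst A g (iseg x 0 p)) (iseg x p p.+1).

Definition iact_edge g x p : edge E :=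
  head (iedge x p) (pedges (act A (rst A g (iseg x 0 p)) (iseg x p p.+1))).

Lemma stepE g x p : pedges (step g x p) = [:: iact_edge g x p].
Proof.
rewrite /iact_edge -/(step g x p); have := act_len A (rst A g (iseg x 0 p)) (iseg x p p.+1).
rewrite -/(step g x p) /plen size_map size_iota subSnn.
by case: (pedges _) => [|e [|]].
Qed.

Lemma step_range g x p : prange (step g x p) = rng (iact_edge g x p).
Proof. by have := pedgesP (step g x p); rewrite stepE /= andbT => /eqP. Qed.

Lemma iact_edgeP g x n : src (iact_edge g x n) = rng (iact_edge g x n.+1).
Proof.
have c := @iseg_cat _ x n n.+1 n.+2 (leqnSn _) (leqnSn _).
have [+ _ _] := act_cat A (rst A g (iseg x 0 n)) c.
rewrite -(rst_cat _ _ (@iseg_cat _ x 0 n n.+1 (leq0n _) (leqnSn _))).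
by rewrite -/(step g x n.+1) -/(step g x n) step_range /psource stepE.
Qed.

Definition iact g x : inf_path E := InfPath (iact_edgeP g x).

Lemma iactE g x p q : (p <= q)%N ->
  iseg (iact g x) p q = act A (rst A g (iseg x 0 p)) (iseg x p q).
Proof.
move=> /subnK <-; elim: (q - p)%N => [|d IH].
  rewrite add0n !iseg_vertex /ivert /= -step_range -/(ivert x p).
  by rewrite act_range.
have pd : (p <= d + p)%N by rewrite leq_addl.
rewrite addSn.
have [_ r1 e1] := @iseg_cat _ (iact g x) p (d + p) (d + p).+1 pd (leqnSn _).
have := act_cat A (rst A g (iseg x 0 p))
  (@iseg_cat _ x p (d + p) (d + p).+1 pd (leqnSn _)).
rewrite -(rst_cat _ _ (@iseg_cat _ x 0 p (d + p) (leq0n _) pd)) -IH.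
case=> _ r2 e2; apply: gpathP; first by rewrite r2 -r1.
by rewrite e1 e2 -/(step g x (d + p)) stepE /= subSnn.
Qed.

Definition rstx g x : nat -> int := fun p => rst A g (iseg x 0 p).

Definition fixer (v : vert E) : set int :=
  [set g | forall y, irange y = v -> iact g y = y].

Lemma iact_idP g y :
  iact g y = y <-> forall n, act A g (iseg y 0 n) = iseg y 0 n.
Proof.
have E0 n : iseg (iact g y) 0 n = act A g (iseg y 0 n).
  by rewrite iactE // iseg_vertex rst_vertex.
split=> [gy n|gy]; first by rewrite -E0 gy.
apply: inf_pathP => n.
have nE (z : inf_path E) : nth (iedge y n) (pedges (iseg z 0 n.+1)) n = iedge z n.
  by rewrite (nth_map 0%N) ?size_iota ?subn0 // nth_iota.
by rewrite -nE E0 gy nE.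
Qed.

Lemma fixerP v g : fixer v g <-> forall y n, irange y = v ->
  act A g (iseg y 0 n) = iseg y 0 n.
Proof.
by split=> [fg y n /fg/iact_idP|fg y yv]; [exact|apply/iact_idP => n; exact: fg].
Qed.

Lemma fixer0 v : fixer v 0.
Proof. by apply/fixerP => y n _; rewrite act0. Qed.

Lemma fixerB v g h : fixer v g -> fixer v h -> fixer v (g - h).
Proof.
move=> /fixerP fg /fixerP fh; apply/fixerP => y n yv; rewrite actD.
have {2}<- : act A (- h) (act A h (iseg y 0 n)) = iseg y 0 n.
  by rewrite -actD addNr act0.
by rewrite fh // -actD addrC actD fg // -{1}(fh y n yv) -actD addNr act0.
Qed.

(* The m >= 0 with B = mZ, meaningful when B is a subgroup; see [fixer_gen]
   and [gen_of_unique]. *)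
Definition gen_of (B : set int) : nat :=
  xget 0%N [set m : nat | B = [set m%:Z * k | k in [set: int]]].

Lemma gen_of_unique (B : set int) (m : nat) :
  B = [set m%:Z * k | k in [set: int]] -> gen_of B = m.
Proof.
move=> Bm; have ex : exists n : nat, B = [set n%:Z * k | k in [set: int]].
  by exists m.
have Bg : B = [set (gen_of B)%:Z * k | k in [set: int]] := xgetPex 0%N ex.
have B1 (n : nat) : B = [set n%:Z * k | k in [set: int]] -> B n%:Z.
  by move=> ->; exists 1 => //; rewrite mulr1.
have := B1 _ Bm; rewrite {1}Bg => -[k _ gk].
have := B1 _ Bg; rewrite {1}Bm => -[l _ ml].
apply/eqP; rewrite eqn_dvd; apply/andP; split.
  by have /(congr1 absz) := gk; rewrite abszM /= => <-; rewrite dvdn_mulr.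
by have /(congr1 absz) := ml; rewrite abszM /= => <-; rewrite dvdn_mulr.
Qed.

Lemma fixer_gen v : fixer v = [set (gen_of (fixer v))%:Z * k | k in [set: int]].
Proof.
suff ex : exists m : nat, fixer v = [set m%:Z * k | k in [set: int]].
  exact: (@xgetPex _ 0%N
    [set m : nat | fixer v = [set m%:Z * k | k in [set: int]]] ex).
set B := fixer v.
have B0 : B 0 by exact: fixer0.
have BB a b : B a -> B b -> B (a - b) by exact: fixerB.
have BN a : B a -> B (- a) by move=> Ba; rewrite -sub0r; exact: BB.
have BD a b : B a -> B b -> B (a + b).
  by move=> Ba Bb; rewrite -[b]opprK; apply: BB => //; exact: BN.
have BM a k : B a -> B (a * k).
  move=> Ba; have Bn n : B (a * n%:Z).
    elim: n => [|n IH]; first by rewrite mulr0.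
    by rewrite intS mulrDr mulr1; exact: BD.
  by case: k => n //; rewrite NegzE mulrN; apply: BN.
have [[m [m0 Bm]]|no] := pselect (exists m : nat, (0 < m)%N /\ B m%:Z); last first.
  exists 0%N; apply/seteqP; split=> [b Bb|b [k _ <-]]; last by apply: (BM 0); exact: B0.
  exists 0 => //; rewrite mulr0; apply/eqP; rewrite eq_sym -absz_eq0.
  apply: contra_notT no; rewrite -lt0n => b0; exists `|b|%N; split=> //.
  by case/orP: (le_total 0 b) => hb; [rewrite gez0_abs|rewrite lez0_abs //; apply: BN].
have ex : exists m, (0 < m)%N && `[< B m%:Z >].
  by exists m; rewrite m0; apply/asboolP.
case: (ex_minnP ex) => n /andP[n0 /asboolP Bn] nmin; exists n.
apply/seteqP; split=> [b Bb|b [k _ <-]]; last exact: BM.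
have nz : n%:Z != 0 by lia.
have Br : B (b %% n%:Z)%Z.
  have -> : (b %% n%:Z)%Z = b - n%:Z * (b %/ n%:Z)%Z.
    by rewrite {2}(divz_eq b n%:Z); lia.
  by apply: BB => //; exact: BM.
have r0 := modz_ge0 b nz; have rn := ltz_pmod b (_ : 0 < n%:Z).
exists (b %/ n%:Z)%Z => //; rewrite [RHS](divz_eq b n%:Z) mulrC.
suff -> : (b %% n%:Z)%Z = 0 by rewrite addr0.
apply/eqP; apply: contraT => rnz.
have /nmin : (0 < `|(b %% n%:Z)%Z|)%N && `[< B `|(b %% n%:Z)%Z|%N%:Z >].
  by rewrite absz_gt0 rnz gez0_abs //; apply/asboolP.
by have := rn ltac:(lia); lia.
Qed.

End InfiniteAction.

Definition evzero : {pred nat -> int} :=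
  fun f => `[< \forall p \near \oo, f p = 0 >].

Lemma evzero_zmod : zmod_closed evzero.
Proof.
split=> [|f g /asboolP f0 /asboolP g0]; apply/asboolP; first exact: nearW.
near=> p; change (f p - g p = 0).
by rewrite (near f0 p) // (near g0 p) // subr0.
Unshelve. all: by end_near. Qed.

HB.instance Definition _ := GRing.isZmodClosed.Build (nat -> int) evzero evzero_zmod.

Definition QNZ : zmodType := Quotient.quot evzero.

Definition Qclass (f : nat -> int) : QNZ := \pi_(Quotient.quot evzero) f.

Lemma QclassP (f g : nat -> int) :
  Qclass f = Qclass g <-> \forall p \near \oo, f p = g p.
Proof.
rewrite /Qclass; split=> [/eqP|fg].
  rewrite -Quotient.idealrBE => /asboolP; apply: filterS => p.
  by move=> fg; apply/eqP; rewrite -subr_eq0; apply/eqP.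
apply/eqP; rewrite -Quotient.idealrBE; apply/asboolP; apply: filterS fg => p fg.
by change (f p - g p = 0); rewrite fg subrr.
Qed.

Lemma QclassB (f g : nat -> int) : Qclass (f - g) = Qclass f - Qclass g.
Proof. exact: (raddfB (\pi_(Quotient.quot evzero))). Qed.

Lemma Qclass_repr (q : QNZ) : Qclass (repr (q : Quotient.quot evzero)) = q.
Proof. exact: reprK. Qed.

(* T_n on functions; on Q(N, Z) it is computed on representatives, see [TnE]. *)
Definition Tn_fun (n : int) (f : nat -> int) : nat -> int :=
  fun p => if n <= p%:Z then f `|p%:Z - n|%N else 0.

Definition Tn (n : int) (q : QNZ) : QNZ :=
  Qclass (Tn_fun n (repr (q : Quotient.quot evzero))).

Lemma TnE (n : int) (f : nat -> int) : Tn n (Qclass f) = Qclass (Tn_fun n f).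
Proof.
apply/QclassP; have /QclassP [N _ fN] := Qclass_repr (Qclass f).
exists (N + `|n|)%N => // p /= pN; rewrite /Tn_fun; case: ifP => // np.
by apply: fN => /=; lia.
Qed.

Lemma TnB (n : int) (q r : QNZ) : Tn n (q - r) = Tn n q - Tn n r.
Proof.
rewrite -[q]Qclass_repr -[r]Qclass_repr -QclassB !TnE -QclassB.
congr Qclass; apply: funext => p.
by rewrite /Tn_fun !fctE; case: ifP => //; rewrite subr0.
Qed.

Section Ssym.
Variables (E : graph) (A : self_similar E).
Implicit Types (x y : inf_path E).

(* The element (x; T_n([f|_(sigma^n x)]), 0; x) is represented by its middle
   coordinate, the only one which is not constant. *)
Definition Selt x (n : nat) (f : int) : QNZ :=
  Tn n%:Z (Qclass (rstx A f (ishift n x))).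

Definition Ssym_pred x : {pred QNZ} := fun q =>
  `[< exists n f, fixer A (ivert x n) f /\ q = Selt x n f >].

Lemma iseg_shift x n p q : iseg (ishift n x) p q = iseg x (n + p) (n + q).
Proof.
apply: gpathP => //=.
by rewrite subnDl -[in RHS](addnC p) -[in RHS](addnC n) iotaDl -map_comp.
Qed.

Lemma rstxB x f g : fixer A (irange x) f -> fixer A (irange x) g ->
  rstx A (f - g) x = rstx A f x - rstx A g x.
Proof.
move=> /fixerP ff /fixerP fg; apply: funext => p; rewrite /rstx !fctE.
have gx : act A (- g) (iseg x 0 p) = iseg x 0 p.
  by rewrite -{1}(fg x p erefl) -actD addNr act0.
rewrite rstD gx; congr (_ + _); apply/eqP; rewrite -addr_eq0 -{2}gx.
by rewrite addrC -rstD subrr rst0.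
Qed.

Lemma SeltB x n f g : fixer A (ivert x n) f -> fixer A (ivert x n) g ->
  Selt x n (f - g) = Selt x n f - Selt x n g.
Proof.
move=> ff fg; have nE : irange (ishift n x) = ivert x n by rewrite /irange /= addn0.
by rewrite /Selt rstxB ?nE // QclassB TnB.
Qed.

Lemma icons_proof (e : edge E) y (ey : src e = irange y) n :
  src (if n is k.+1 then iedge y k else e) = rng (iedge y n).
Proof. by case: n => [|n] //; exact: iedgeP. Qed.

Definition icons (e : edge E) y (ey : src e = irange y) : inf_path E :=
  @InfPath E (fun n => if n is k.+1 then iedge y k else e) (icons_proof ey).

Lemma iseg_icons (e : edge E) y (ey : src e = irange y) p q :
  iseg (icons ey) p.+1 q.+1 = iseg y p q.
Proof.
apply: gpathP => //=.
by rewrite subSS -[p.+1]addn1 addnC iotaDl -map_comp.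
Qed.

Lemma fixer_rst x n f : fixer A (ivert x n) f ->
  fixer A (ivert x n.+1) (rst A f (iseg x n n.+1)).
Proof.
move=> /fixerP ff; apply/fixerP => y p yv.
have ey : src (iedge x n) = irange y by rewrite yv; exact: iedgeP.
have e1 : iseg (icons ey) 0 1 = iseg x n n.+1.
  by apply: gpathP => //=; rewrite subSnn.
have c := @iseg_cat _ (icons ey) 0 1 p.+1 (leq0n _) isT.
have := act_cat A f c; rewrite (ff (icons ey) p.+1 erefl).
rewrite (ff (icons ey) 1%N erefl) e1 iseg_icons => -[r1 _ a1].
have [r2 _ a2] := c; rewrite e1 iseg_icons in r2 a2.
apply: gpathP; first by rewrite -r1 -r2.
by move: a1; rewrite a2 => /eqP; rewrite eqseq_cat // eqxx => /eqP.
Qed.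

Lemma Selt_step x n f :
  Selt x n f = Selt x n.+1 (rst A f (iseg x n n.+1)).
Proof.
rewrite /Selt !TnE; apply/QclassP; exists n.+1 => // p /= np.
rewrite /Tn_fun !ifT; [|lia|lia]; rewrite /rstx !iseg_shift !addn0.
have -> : (n + `|p%:Z - n%:Z| = p)%N by lia.
have -> : (n.+1 + `|p%:Z - n.+1%:Z| = p)%N by lia.
by rewrite -(rst_cat _ _ (@iseg_cat _ x n n.+1 p (leqnSn _) np)).
Qed.

Lemma Selt_le x n m f : (n <= m)%N -> fixer A (ivert x n) f ->
  exists2 g, fixer A (ivert x m) g & Selt x n f = Selt x m g.
Proof.
move=> /subnK <-; elim: (m - n)%N => [|d IH] ff; first by exists f.
have [g fg ->] := IH ff.
by exists (rst A g (iseg x (d + n) (d + n).+1)); [exact: fixer_rst|exact: Selt_step].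
Qed.

Lemma Ssym_zmod x : zmod_closed (Ssym_pred x).
Proof.
split=> [|q r /asboolP[n [f [ff ->]]] /asboolP[m [g [fg ->]]]]; apply/asboolP.
  exists 0%N, 0; split; first exact: fixer0.
  have f0 := @fixer0 _ A (ivert x 0); have := SeltB f0 f0.
  by rewrite !subrr.
have [f' ff' ->] := Selt_le (leq_maxl n m) ff.
have [g' fg' ->] := Selt_le (leq_maxr n m) fg.
by exists (maxn n m), (f' - g'); split; [exact: fixerB|rewrite SeltB].
Qed.

HB.instance Definition _ x :=
  GRing.isZmodClosed.Build QNZ (Ssym_pred x) (Ssym_zmod x).

(* Written additively. *)
Definition Ssym x := {q : QNZ | q \in Ssym_pred x}.

HB.instance Definition _ x := SubChoice.on (Ssym x).
HB.instance Definition _ x := [SubChoice_isSubZmodule of Ssym x by <:].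

Definition hgen x (n : nat) : int := (gen_of (fixer A (ivert x n)))%:Z.

Lemma hgen_fixer x n : fixer A (ivert x n) (hgen x n).
Proof. by rewrite fixer_gen; exists 1 => //; rewrite mulr1. Qed.

Lemma sgen_proof x n : Selt x n (hgen x n) \in Ssym_pred x.
Proof. by apply/asboolP; exists n, (hgen x n); split=> //; exact: hgen_fixer. Qed.

Definition sgen x (n : nat) : Ssym x := Sub (Selt x n (hgen x n)) (sgen_proof x n).

(* Division in [int] yields 0 when the divisor is 0. *)
Definition kexp x (n : nat) : int :=
  (rst A (hgen x n) (iseg x n n.+1) %/ hgen x n.+1)%Z.

Lemma kexpP x n : rst A (hgen x n) (iseg x n n.+1) = hgen x n.+1 * kexp x n.
Proof.
have := @fixer_rst x n _ (@hgen_fixer x n); rewrite fixer_gen => -[k _].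
rewrite -/(hgen x n.+1) /kexp => <-; have [->|h0] := eqVneq (hgen x n.+1) 0.
  by rewrite !mul0r.
by rewrite [X in (X %/ _)%Z]mulrC mulzK.
Qed.

Definition kprod x (i j : nat) : int := \prod_(i <= n < j) kexp x n.

End Ssym.

Section Circle.
Variable R : realType.

Definition circle := {z : R[i] | `|z| == 1}.

HB.instance Definition _ := SubChoice.on circle.
HB.instance Definition _ := Topological.copy circle
  (initial_topology ((fun z => val z) : circle -> (R[i])^o)).

Lemma circle_neq0 (z : circle) : val z != 0.
Proof. by rewrite -normr_gt0 (eqP (valP z)). Qed.

Lemma circle_one_proof : `|1 : R[i]| == 1.
Proof. by rewrite normr1. Qed.

Lemma circle_mul_proof (z w : circle) : `|val z * val w| == 1.
Proof. by rewrite normrM (eqP (valP z)) (eqP (valP w)) mulr1. Qed.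

Lemma circle_pow_proof (z : circle) (k : int) : `|val z ^ k| == 1.
Proof.
case: k => k; first by rewrite -exprnP normrX (eqP (valP z)) expr1n.
by rewrite NegzE -exprnN normfV normrX (eqP (valP z)) expr1n invr1.
Qed.

Definition circle_one : circle := exist _ 1 circle_one_proof.
Definition circle_mul (z w : circle) : circle :=
  exist _ (val z * val w) (circle_mul_proof z w).
Definition circle_pow (z : circle) (k : int) : circle :=
  exist _ (val z ^ k) (circle_pow_proof z k).
Definition circle_inv (z : circle) : circle := circle_pow z (-1).

Lemma circle_mulA : associative circle_mul.
Proof. by move=> u v w; apply: val_inj; rewrite /= mulrA. Qed.
Lemma circle_mul1 : left_id circle_one circle_mul.
Proof. by move=> u; apply: val_inj; rewrite /= mul1r. Qed.
Lemma circle_1mul : right_id circle_one circle_mul.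
Proof. by move=> u; apply: val_inj; rewrite /= mulr1. Qed.
Lemma circle_mulV : left_inverse circle_one circle_inv circle_mul.
Proof. by move=> u; apply: val_inj; rewrite /= exprN1 mulVf // circle_neq0. Qed.
Lemma circle_Vmul : right_inverse circle_one circle_inv circle_mul.
Proof. by move=> u; apply: val_inj; rewrite /= exprN1 mulfV // circle_neq0. Qed.

HB.instance Definition _ := isGroup.Build circle
  circle_mulA circle_mul1 circle_1mul circle_mulV circle_Vmul.

Lemma circle_mulC (z w : circle) : (z * w = w * z)%g.
Proof. by apply: val_inj; rewrite /= mulrC. Qed.

Lemma circle_powM (k : int) : {morph circle_pow^~ k : z w / (z * w)%g}.
Proof. by move=> z w; apply: val_inj; rewrite /= expfzMl. Qed.

Lemma circle_pow1 (k : int) : circle_pow 1%g k = 1%g.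
Proof. by apply: val_inj; rewrite /= exp1rz. Qed.

Lemma circle_powV (k : int) (z : circle) :
  circle_pow z^-1%g k = (circle_pow z k)^-1%g.
Proof.
apply: val_inj; change ((val z ^ (-1)) ^ k = (val z ^ k) ^ (-1)).
by rewrite !exprz_exp mulrC.
Qed.

End Circle.

Section Dual.
Variables (R : realType) (E : graph) (A : self_similar E) (x : inf_path E).

(* S_sym(x) is discrete, so every homomorphism is continuous. *)
Record Sdual := SDual {
  dual_fun :> Ssym A x -> circle R;
  dualM : forall s t, dual_fun (s + t) = (dual_fun s * dual_fun t)%g
}.

Lemma dualP (kappa lambda : Sdual) :
  (forall s, kappa s = lambda s) -> kappa = lambda.
Proof.
case: kappa lambda => [f p] [g q] /= /funext fg.
by case: g / fg q => q; rewrite (Prop_irrelevance p q).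
Qed.

HB.instance Definition _ := gen_eqMixin Sdual.
HB.instance Definition _ := gen_choiceMixin Sdual.
HB.instance Definition _ := Topological.copy Sdual
  (initial_topology (dual_fun : Sdual -> {ptws Ssym A x -> circle R})).

Definition dual_one : Sdual :=
  @SDual (fun=> 1%g) (fun _ _ => esym (mul1g 1%g)).

Lemma dual_mul_proof (kappa lambda : Sdual) s t :
  (kappa (s + t) * lambda (s + t) = kappa s * lambda s * (kappa t * lambda t))%g.
Proof.
rewrite !dualM -!mulgA; congr (_ * _)%g.
by rewrite !mulgA (circle_mulC (kappa t)).
Qed.

Definition dual_mul (kappa lambda : Sdual) : Sdual :=
  @SDual (fun s => kappa s * lambda s)%g (dual_mul_proof kappa lambda).

Lemma dual_inv_proof (kappa : Sdual) s t :
  ((kappa (s + t))^-1 = (kappa s)^-1 * (kappa t)^-1)%g.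
Proof. by rewrite dualM circle_mulC invgM. Qed.

Definition dual_inv (kappa : Sdual) : Sdual :=
  @SDual (fun s => (kappa s)^-1)%g (dual_inv_proof kappa).

Lemma dual_mulA : associative dual_mul.
Proof. by move=> u v w; apply: dualP => s /=; rewrite mulgA. Qed.
Lemma dual_mul1 : left_id dual_one dual_mul.
Proof. by move=> u; apply: dualP => s /=; rewrite mul1g. Qed.
Lemma dual_1mul : right_id dual_one dual_mul.
Proof. by move=> u; apply: dualP => s /=; rewrite mulg1. Qed.
Lemma dual_mulV : left_inverse dual_one dual_inv dual_mul.
Proof. by move=> u; apply: dualP => s /=; rewrite mulVg. Qed.
Lemma dual_Vmul : right_inverse dual_one dual_inv dual_mul.
Proof. by move=> u; apply: dualP => s /=; rewrite mulgV. Qed.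

HB.instance Definition _ := isGroup.Build Sdual
  dual_mulA dual_mul1 dual_1mul dual_mulV dual_Vmul.

End Dual.

Section InverseLimit.
Variables (R : realType) (E : graph) (A : self_similar E) (x : inf_path E).

(* The group X_i(x), as a subgroup of the circle. *)
Definition Xgrp (i : nat) : set (circle R) :=
  if pselect (exists n, hgen A x n != 0) is left ex
  then if (i < ex_minn ex)%N then [set 1%g] else [set: circle R]
  else [set 1%g].

Definition fij (i j : nat) (z : circle R) : circle R :=
  circle_pow z (kprod A x i j).

Lemma Xgrp_closed i : [/\ Xgrp i 1%g,
  forall z w, Xgrp i z -> Xgrp i w -> Xgrp i (z * w)%g
  & forall z, Xgrp i z -> Xgrp i z^-1%g].
Proof.
have t : [/\ [set 1%g] (1%g : circle R),
    forall z w : circle R, [set 1%g] z -> [set 1%g] w -> [set 1%g] (z * w)%g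
    & forall z : circle R, [set 1%g] z -> [set 1%g] z^-1%g].
  by split=> // [z w -> ->|z ->]; rewrite /= ?mulg1 ?invg1.
by rewrite /Xgrp; case: pselect => // ex; case: ifP.
Qed.

Lemma fij_Xgrp i j z : (i <= j)%N -> Xgrp j z -> Xgrp i (fij i j z).
Proof.
rewrite /Xgrp /fij => ij; case: pselect => [ex|_ -> /=]; last exact: circle_pow1.
case: (ex_minnP ex) => N hN Nmin; case: ltnP => jN; case: ltnP => iN //.
  by move=> -> /=; exact: circle_pow1.
move=> _ /=; suff -> : kprod A x i j = 0 by apply: val_inj; rewrite /= expr0z.
have kN : kexp A x N.-1 = 0.
  have N0 : N = N.-1.+1 by rewrite prednK //; lia.
  have h0 : hgen A x N.-1 = 0.
    by apply/eqP; apply: contraT => /Nmin; lia.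
  by rewrite /kexp h0 rst0 div0z.
have iN' : (i <= N.-1)%N by lia.
have jN' : (N.-1 < j)%N by lia.
rewrite /kprod (big_cat_nat iN' (ltnW jN')) /=.
by rewrite [X in _ * X](big_ltn jN') kN mul0r mulr0.
Qed.

Lemma fij_id i z : fij i i z = z.
Proof. by apply: val_inj; rewrite /= /kprod big_geq // expr1z. Qed.

Lemma fij_comp i j l z : (i <= j)%N -> (j <= l)%N ->
  fij i j (fij j l z) = fij i l z.
Proof.
move=> ij jl; apply: val_inj.
by rewrite /= exprz_exp mulrC /kprod (big_cat_nat ij jl).
Qed.

Record invlim := InvLim {
  pr : nat -> circle R;
  pr_Xgrp : forall i, Xgrp i (pr i);
  pr_fij : forall i j, (i <= j)%N -> pr i = fij i j (pr j)
}.

Lemma invlimP (z w : invlim) : (forall i, pr z i = pr w i) -> z = w.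
Proof.
case: z w => [f p p'] [g q q'] /= /funext fg; case: g / fg q q' => q q'.
by rewrite (Prop_irrelevance p q) (Prop_irrelevance p' q').
Qed.

HB.instance Definition _ := gen_eqMixin invlim.
HB.instance Definition _ := gen_choiceMixin invlim.
HB.instance Definition _ := Topological.copy invlim
  (initial_topology (pr : invlim -> prod_topology (fun _ : nat => circle R))).

Definition invlim_one : invlim.
Proof.
exists (fun=> 1%g); first by move=> i; have [] := Xgrp_closed i.
by move=> i j _; rewrite /fij circle_pow1.
Defined.

Definition invlim_mul (z w : invlim) : invlim.
Proof.
exists (fun i => pr z i * pr w i)%g => [i|i j ij].
  by have [_ + _] := Xgrp_closed i; apply; exact: pr_Xgrp.
by rewrite /fij circle_powM (pr_fij z ij) (pr_fij w ij).
Defined.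

Definition invlim_inv (z : invlim) : invlim.
Proof.
exists (fun i => (pr z i)^-1)%g => [i|i j ij].
  by have [_ _] := Xgrp_closed i; apply; exact: pr_Xgrp.
by rewrite /fij circle_powV (pr_fij z ij).
Defined.

Lemma invlim_mulA : associative invlim_mul.
Proof. by move=> u v w; apply: invlimP => s /=; rewrite mulgA. Qed.
Lemma invlim_mul1 : left_id invlim_one invlim_mul.
Proof. by move=> u; apply: invlimP => s /=; rewrite mul1g. Qed.
Lemma invlim_1mul : right_id invlim_one invlim_mul.
Proof. by move=> u; apply: invlimP => s /=; rewrite mulg1. Qed.
Lemma invlim_mulV : left_inverse invlim_one invlim_inv invlim_mul.
Proof. by move=> u; apply: invlimP => s /=; rewrite mulVg. Qed.
Lemma invlim_Vmul : right_inverse invlim_one invlim_inv invlim_mul.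
Proof. by move=> u; apply: invlimP => s /=; rewrite mulgV. Qed.

HB.instance Definition _ := isGroup.Build invlim
  invlim_mulA invlim_mul1 invlim_1mul invlim_mulV invlim_Vmul.

End InverseLimit.

(* Main.v *)
Require Import Defs.
From mathcomp Require Import all_boot all_order all_algebra.
From mathcomp Require Import all_classical all_reals all_analysis.
From mathcomp Require Import complex zify.
Set Implicit Arguments.
Unset Strict Implicit.
Unset Printing Implicit Defensive.
Import GRing.Theory.
Import numFieldNormedType.Exports.
Local Open Scope classical_set_scope.
Local Open Scope ring_scope.

(** The group S_sym(x) is the increasing union of the cyclic groups generated
    by the elements s_n: an element T_n([f|_(sigma^n x)]) has f = h_n^k, so it
    is the k-th multiple of s_n ([sgen_span]), and passing from level n to level
    n + 1 replaces h_n by its restriction, a k_n-th power of h_(n+1), so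
    s_i = k_(i,j) s_j for i <= j ([sgen_kprod]).  A character kappa is therefore
    determined by its values kappa(s_n) ([dual_ext]), and these values satisfy
    exactly the compatibility relations of the inverse system.  They lie in the
    prescribed groups since s_n is trivial whenever h_n is ([dual_Xgrp]).  This
    gives the injective homomorphism Omega, here [lim_of_dual].

    To invert it, a compatible sequence z must define a character by
    k s_n |-> z_n ^ k.  The only issue is whether the value depends on the
    representation of the element ([pr_sgenMz]).  After moving two
    representations to a common level p, their difference is a relation
    d s_p = 0.  Pseudo-freeness makes restriction to initial segments of
    sigma^p(x) injective on the elements fixing them, so the relation forces
    h_p^d = 1 ([sgenMz_eq0]), hence d = 0 or h_p = 1.  In the second case z_p
    is 1 because, again by pseudo-freeness, the levels at which h is trivial
    form an initial segment, which is where X_p(x) is the trivial group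
    ([hgen0_down], [pr_hgen0]).

    Both topologies are topologies of pointwise convergence, so continuity is
    tested on coordinates: those of Omega are evaluations of characters, those
    of its inverse are powers of the projections of the inverse limit. *)

Lemma continuous_to_prod {X : topologicalType} {I : eqType}
    {K : I -> topologicalType} (f : X -> prod_topology K) :
  (forall i, continuous (fun x => f x i : K i)) -> continuous f.
Proof.
move=> cf x; apply/cvg_sup => i.
exact: (@continuous_comp_initial _ _ _ (fun g : prod_topology K => g i) f (cf i)).
Qed.

Lemma initial_coord_continuous {S : choiceType} {I : eqType}
    {K : I -> topologicalType} (f : S -> prod_topology K) (i : I) :
  continuous (fun x : initial_topology f => f x i : K i).
Proof.
move=> x; apply: (@continuous_comp _ _ _ (f : initial_topology f -> _) (@proj I K i)).
  exact: initial_continuous.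
exact: proj_continuous.
Qed.

Lemma expr_continuous {K : numFieldType} n : continuous (fun w : K => w ^+ n).
Proof.
elim: n => [|n IH] w.
  by have -> : (fun w : K => w ^+ 0) = cst 1; [apply: funext|exact: cst_continuous].
have -> : (fun w : K => w ^+ n.+1) = (fun w => w * w ^+ n).
  by apply: funext => v; rewrite exprS.
exact: (@continuousM K K id (fun v => v ^+ n) w (@cvg_id _ _) (IH w)).
Qed.

Lemma exprz_continuous {K : numFieldType} (k : int) (w : K) : w != 0 ->
  {for w, continuous (fun v : K => v ^ k)}.
Proof.
move=> w0; case: k => n; first exact: expr_continuous.
apply: (@continuousV K K (fun v => v ^+ n.+1)); first exact: expf_neq0.
exact: expr_continuous.
Qed.

Section CirclePower.
Context {R : realType}.
Implicit Types (z : circle R) (k l : int).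

Lemma circle_powD z k l :
  circle_pow z (k + l) = (circle_pow z k * circle_pow z l)%g.
Proof. by apply: val_inj; rewrite /= expfzDr // circle_neq0. Qed.

Lemma circle_pow_exp z k l : circle_pow (circle_pow z k) l = circle_pow z (k * l).
Proof. by apply: val_inj; rewrite /= exprz_exp. Qed.

Lemma circle_expr0 z : circle_pow z 0 = 1%g.
Proof. by apply: val_inj; rewrite /= expr0z. Qed.

Lemma circle_expr1 z : circle_pow z 1 = z.
Proof. by apply: val_inj; rewrite /= expr1z. Qed.

Lemma circle_pow_continuous k : continuous ((@circle_pow R)^~ k).
Proof.
have val_cont : continuous (fun z : circle R => val z : (R[i])^o).
  exact: initial_continuous.
apply: continuous_comp_initial => z.
apply: (@continuous_comp _ _ _ (fun z : circle R => val z : (R[i])^o)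
  (fun w : (R[i])^o => w ^ k)); first exact: val_cont.
by apply: exprz_continuous; exact: circle_neq0.
Qed.

End CirclePower.

Section Generators.
Context {E : graph} {A : self_similar E} {x : inf_path E}.
Implicit Types (n i j : nat) (f k : int) (s : Ssym A x).

Lemma Selt0 n : Selt A x n 0 = 0.
Proof.
by have f0 := @fixer0 _ A (ivert x n); have := SeltB f0 f0; rewrite !subrr.
Qed.

(** On the fixer of x(n, n) the map f |-> T_n([f|_(sigma^n x)]) is a
    homomorphism by [SeltB], so it commutes with integer multiples. *)
Lemma SeltM n f k : fixer A (ivert x n) f -> Selt A x n (f * k) = Selt A x n f *~ k.
Proof.
move=> ff.
have f0 := @fixer0 _ A (ivert x n); have S0 := Selt0 n.
have SN g : fixer A (ivert x n) g ->
    fixer A (ivert x n) (- g) /\ Selt A x n (- g) = - Selt A x n g.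
  move=> fg; rewrite -[- g]sub0r -[- Selt _ _ _ _]sub0r; split; first exact: fixerB.
  by rewrite SeltB // S0.
have Sn m : fixer A (ivert x n) (f * m%:Z) /\
    Selt A x n (f * m%:Z) = Selt A x n f *~ m%:Z.
  elim: m => [|m [IH IS]]; first by rewrite mulr0.
  have [fN SNf] := SN _ ff.
  (* Written as a difference because [SeltB] is about differences. *)
  have -> : f * m.+1%:Z = f * m%:Z - (- f) by rewrite intS; lia.
  split; first exact: fixerB.
  by rewrite SeltB // IS SNf opprK intS mulrzDr mulr1z addrC.
case: k => m; first by have [] := Sn m.
have [fm Sm] := Sn m.+1; rewrite NegzE mulrN mulrNz -Sm.
by have [] := SN _ fm.
Qed.

Lemma val_sgenMz n k : val (sgen A x n *~ k) = Selt A x n (hgen A x n * k).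
Proof. by rewrite raddfMz SeltM //; exact: hgen_fixer. Qed.

(** The relation that turns the values of a character on the s_n into a point
    of the inverse limit. *)
Lemma sgen_kprod i j : (i <= j)%N -> sgen A x i = sgen A x j *~ kprod A x i j.
Proof.
move=> /subnK <-; elim: (j - i)%N => [|d IH].
  by rewrite add0n /kprod big_geq // mulr1z.
rewrite IH /kprod addSn big_nat_recr /= ?leq_addl // mulrC mulrzA.
congr (_ *~ _); apply: val_inj.
by rewrite val_sgenMz -kexpP -Selt_step.
Qed.

Lemma sgen_span s : exists nk : nat * int, s = sgen A x nk.1 *~ nk.2.
Proof.
have /asboolP [n [f [ff sE]]] := valP s.
move: ff sE; rewrite fixer_gen => -[k _ <-] sE.
by exists (n, k); apply: val_inj; rewrite val_sgenMz.
Qed.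

(** The case k = 1 says that s_n = 0 when h_n = 1.  Without pseudo-freeness s_n may also
    vanish for a nontrivial h_n, as its restrictions may become trivial. *)
Lemma sgenMz_of_hgen0 n k : hgen A x n * k = 0 -> sgen A x n *~ k = 0.
Proof. by move=> h0; apply: val_inj; rewrite val_sgenMz h0 Selt0. Qed.

Section PseudoFree.
Hypothesis pf : pseudo_free A.

(** Equality to the class of 0 says that f restricts trivially to a long
    enough initial segment of sigma^n(x); since f also fixes that segment,
    pseudo-freeness applies to this single segment. *)
Lemma Selt_inj0 n f : fixer A (ivert x n) f -> Selt A x n f = 0 -> f = 0.
Proof.
move=> /fixerP ff; rewrite /Selt TnE => S0.
have : Qclass (Tn_fun n (rstx A f (ishift n x))) = Qclass 0.
  by rewrite S0 -(subrr (0 : nat -> int)) QclassB subrr.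
(* At position N + n the shifted function reads f restricted to a segment of
   length N. *)
move=> /QclassP [N _ fN]; have := fN (N + n)%N (leq_addr _ _).
rewrite /Tn_fun ifT; last by lia.
move=> r0; apply: pf r0; apply: ff.
by rewrite /irange /= addn0.
Qed.

Lemma sgenMz_eq0 n k : sgen A x n *~ k = 0 -> hgen A x n * k = 0.
Proof.
move=> /(congr1 val); rewrite val_sgenMz => S0; apply: Selt_inj0 S0.
by rewrite fixer_gen; exists k.
Qed.

(** The index N in the definition of X_i(x) is only the first one with
    h_N <> 1; this shows that h_i <> 1 for all later i as well.  The reason is
    that h_j = 1 gives s_j = 0, hence s_i = k_(i,j) s_j = 0. *)
Lemma hgen0_down i j : (i <= j)%N -> hgen A x j = 0 -> hgen A x i = 0.
Proof.
move=> ij hj; rewrite -[LHS]mulr1; apply: sgenMz_eq0.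
by rewrite mulr1z (sgen_kprod ij) sgenMz_of_hgen0 // hj mul0r.
Qed.

End PseudoFree.
End Generators.

Section Duality.
Context {R : realType} {E : graph} {A : self_similar E} {x : inf_path E}.
Implicit Types (kappa lambda : Sdual R A x) (z : invlim R A x) (n : nat) (k : int).

Lemma dual0 kappa : kappa 0 = 1%g.
Proof.
have := dualM kappa 0 0; rewrite addr0 => e.
by rewrite -[LHS]mulg1 -(mulgV (kappa 0)) mulgA -e.
Qed.

Lemma dualMz kappa s k : kappa (s *~ k) = circle_pow (kappa s) k.
Proof.
have pos m : kappa (s *~ m%:Z) = circle_pow (kappa s) m%:Z.
  elim: m => [|m IH]; first by rewrite mulr0z dual0 circle_expr0.
  by rewrite intS mulrzDr mulr1z dualM IH circle_powD circle_expr1.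
case: k => m; first exact: pos.
rewrite NegzE mulrNz.
have e : (kappa (s *~ m.+1) * kappa (- (s *~ m.+1)) = 1)%g.
  by rewrite -dualM subrr dual0.
have e' : (circle_pow (kappa s) m.+1 * circle_pow (kappa s) (- m.+1%:Z) = 1)%g.
  by rewrite -circle_powD subrr circle_expr0.
by apply: (mulgI (kappa (s *~ m.+1))); rewrite e pos e'.
Qed.

Lemma dual_ext kappa lambda :
  (forall n, kappa (sgen A x n) = lambda (sgen A x n)) -> kappa = lambda.
Proof.
move=> e; apply: dualP => s; have [nk ->] := sgen_span s.
by rewrite !dualMz e.
Qed.

Lemma dual_eval_continuous s : continuous (fun kappa => kappa s).
Proof.
exact: (@initial_coord_continuous _ _ (fun=> circle R) (@dual_fun R E A x)).
Qed.

Lemma pr_continuous n : continuous (fun z => pr z n).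
Proof.
exact: (@initial_coord_continuous _ _ (fun=> circle R) (@pr R E A x)).
Qed.

(** Below the index N every h_n is trivial by minimality, and from N on X_n(x)
    is the whole circle. *)
Lemma Xgrp_hgen n (w : circle R) : (hgen A x n = 0 -> w = 1%g) -> Xgrp A x n w.
Proof.
move=> hw; rewrite /Xgrp; case: pselect => [ex|no]; last first.
  by apply: hw; apply: contra_notP no => /eqP; exists n.
case: (ex_minnP ex) => N _ Nmin; case: ifP => // nN; apply: hw.
by apply/eqP; apply: contraTT nN => /Nmin; rewrite -leqNgt.
Qed.

Lemma dual_Xgrp kappa n : Xgrp A x n (kappa (sgen A x n)).
Proof.
apply: Xgrp_hgen => h0.
by rewrite -[sgen _ _ _]mulr1z sgenMz_of_hgen0 ?dual0 // h0 mul0r.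
Qed.

Lemma dual_fij kappa i j : (i <= j)%N ->
  kappa (sgen A x i) = fij A x i j (kappa (sgen A x j)).
Proof. by move=> ij; rewrite (sgen_kprod ij) dualMz. Qed.

Definition lim_of_dual kappa : invlim R A x :=
  InvLim (dual_Xgrp kappa) (dual_fij kappa).

Lemma lim_of_dual_continuous : continuous lim_of_dual.
Proof.
apply: continuous_comp_initial; apply: continuous_to_prod => n.
exact: dual_eval_continuous.
Qed.

Section PseudoFree.
Hypothesis pf : pseudo_free A.

Lemma pr_hgen0 z n : hgen A x n = 0 -> pr z n = 1%g.
Proof.
move=> h0; have := pr_Xgrp z n; rewrite /Xgrp; case: pselect => // ex.
case: (ex_minnP ex) => N hN _; case: ltnP => // Nn.
by rewrite (hgen0_down pf Nn h0) eqxx in hN.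
Qed.

(** This makes k s_n |-> z_n ^ k well defined: the two multiples are compared
    at the level p = max(n, m), where either the exponents agree or z_p = 1. *)
Lemma pr_sgenMz z n m k l : sgen A x n *~ k = sgen A x m *~ l ->
  circle_pow (pr z n) k = circle_pow (pr z m) l.
Proof.
set p := maxn n m; have np : (n <= p)%N := leq_maxl _ _.
have mp : (m <= p)%N := leq_maxr _ _.
rewrite (sgen_kprod np) (sgen_kprod mp) (pr_fij z np) (pr_fij z mp) /fij.
rewrite !circle_pow_exp -!mulrzA; set a := _ * k; set b := _ * l => e.
have : sgen A x p *~ (a - b) = 0 by rewrite mulrzBr e subrr.
move=> /(sgenMz_eq0 pf) /eqP; rewrite mulf_eq0 subr_eq0 => /orP[]/eqP; last by move->.
by move=> /(pr_hgen0 z) ->; rewrite !circle_pow1.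
Qed.

(** The representation of s as a multiple of some s_n is an arbitrary choice;
    [lim_evalE] shows that the value does not depend on it. *)
Definition lim_eval z (s : Ssym A x) : circle R :=
  let nk := projT1 (cid (sgen_span s)) in circle_pow (pr z nk.1) nk.2.

Lemma lim_evalE z n k : lim_eval z (sgen A x n *~ k) = circle_pow (pr z n) k.
Proof.
by rewrite /lim_eval; case: cid => nk /= e; apply: pr_sgenMz.
Qed.

(** Any two elements are multiples of a single s_p, and on these the map is
    k |-> z_p ^ k. *)
Lemma lim_evalD z s t : lim_eval z (s + t) = (lim_eval z s * lim_eval z t)%g.
Proof.
have [[n k] /= ->] := sgen_span s; have [[m l] /= ->] := sgen_span t.
set p := maxn n m.
rewrite (sgen_kprod (leq_maxl n m)) (sgen_kprod (leq_maxr n m)) -/p.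
by rewrite -!mulrzA -mulrzDr !lim_evalE circle_powD.
Qed.

Definition dual_of_lim z : Sdual R A x := SDual (lim_evalD z).

Lemma dual_of_lim_sgen z n : dual_of_lim z (sgen A x n) = pr z n.
Proof. by rewrite -[sgen _ _ _]mulr1z /= lim_evalE circle_expr1. Qed.

Lemma dual_of_lim_continuous : continuous dual_of_lim.
Proof.
apply: continuous_comp_initial; apply: continuous_to_prod => s /= z.
apply: (@continuous_comp _ _ _ (fun z => pr z _) (fun w => circle_pow w _)).
  exact: pr_continuous.
exact: circle_pow_continuous.
Qed.

End PseudoFree.
End Duality.

Theorem theorem4p4 (R : realType) (E : graph) (A : self_similar E)
    (x : inf_path E) :
  exists Omega : Sdual R A x -> invlim R A x,
    [/\ injective Omega, continuous Omega
      & {morph Omega : kappa lambda / (kappa * lambda)%g}] /\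
    (forall kappa n, pr (Omega kappa) n = kappa (sgen A x n)) /\
    (forall Omega' : Sdual R A x -> invlim R A x,
       (forall kappa n, pr (Omega' kappa) n = kappa (sgen A x n)) ->
       Omega' = Omega) /\
    (pseudo_free A ->
     exists Psi : invlim R A x -> Sdual R A x,
       [/\ cancel Omega Psi, cancel Psi Omega, continuous Psi
         & {morph Psi : z w / (z * w)%g}] /\
       (forall z n, Psi z (sgen A x n) = pr z n) /\
       (forall z (kappa : Sdual R A x),
          (forall n, kappa (sgen A x n) = pr z n) -> kappa = Psi z)).
Proof.
exists lim_of_dual; split; [split|split; [by []|split]].
- move=> kappa lambda e; apply: dual_ext => n.
  exact: (congr1 (fun w => pr w n) e).
- exact: lim_of_dual_continuous.
- by move=> kappa lambda; apply: invlimP.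
- by move=> Omega' e; apply: funext => kappa; apply: invlimP => n; rewrite e.
move=> pf; exists (dual_of_lim pf); split; [split|split].
- by move=> kappa; apply: dual_ext => n; rewrite dual_of_lim_sgen.
- by move=> z; apply: invlimP => n; exact: dual_of_lim_sgen.
- exact: dual_of_lim_continuous.
- move=> z w; apply: dual_ext => n.
  change ((dual_of_lim pf z * dual_of_lim pf w)%g (sgen A x n))
    with (dual_of_lim pf z (sgen A x n) * dual_of_lim pf w (sgen A x n))%g.
  by rewrite !dual_of_lim_sgen.
- exact: dual_of_lim_sgen.
- by move=> z kappa e; apply: dual_ext => n; rewrite dual_of_lim_sgen.
Qed.
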